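(* Assume $k$ has characteristic $0$. Let $I \subset S = k[x_1,\ldots,x_n]$ be an $\mathfrak m$-primary homogeneous ideal of asymptotic generating degree $d$, and write $\operatorname{reg} I^m = dm + e_m$ for all $m$. Let $d+b$ be the maximal degree of a minimal generator of $I$, let $d+b'$ be the minimal degree strictly greater than $d$ of a minimal generator of $I$ ($b' = \infty$ if no such generator exists), and let $I_{\leq d}$ be the ideal generated by the elements of $I$ of degree at most $d$. Then \begin{enumerate} \item $e_{m+1} \leq e_m + b$ for all $m > 0$; \item $e_{m+1} \leq e_m$ for all $m > (\operatorname{reg} I_{\leq d})/(d+b')$. \end{enumerate} Moreover, the latter case holds whenever $m \geq n$; that is, $e_{m+1} \le e_m$ for all $m \ge n$.
   Context: $S = k[x_1,\ldots,x_n]$ is a polynomial ring over a field $k$ with its standard grading, $\mathfrak m = (x_1,\ldots,x_n)$, and $\operatorname{reg}$ denotes Castelnuovo-Mumford regularity. $m$ ranges over positive integers. $I_{\leq t}$ denotes the ideal generated by the forms in $I$ of degree at most $t$; the asymptotic generating degree of $I$ is the minimal number $d$ such that $I$ is integral over $I_{\leq d}$. When $b' = \infty$, the quotient $(\operatorname{reg} I_{\leq d})/(d+b')$ is read as $0$. *)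

(* Defs.v *)
From HB Require Import structures.
From mathcomp Require Import all_boot all_order all_algebra.
From mathcomp Require Import mpoly.
Set Implicit Arguments.
Unset Strict Implicit.
Unset Printing Implicit Defensive.
Import Order.TTheory GRing.Theory Num.Theory.
Local Open Scope ring_scope.

(* Ideals are Prop-valued predicates: the library's [idealr] asks for a
   decidable proper ideal, which would exclude generated ideals. *)
Section CommutativeAlgebra.
Variable S : comNzRingType.
Implicit Types (I J A : S -> Prop) (f g : S).

Definition is_ideal I : Prop :=
  [/\ I 0, forall f g, I f -> I g -> I (f + g) & forall f g, I g -> I (f * g)].

Definition ideal_gen A : S -> Prop := fun f =>
  exists (N : nat) (c g : 'I_N -> S),
    (forall i, A (g i)) /\ f = \sum_(i < N) c i * g i.

Definition ideal_pow I (m : nat) : S -> Prop :=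
  ideal_gen (fun f =>
    exists g : 'I_m -> S, (forall i, I (g i)) /\ f = \prod_(i < m) g i).

Definition radical I : S -> Prop := fun f => exists N : nat, I (f ^+ N).

Definition is_primary I : Prop :=
  [/\ is_ideal I, ~ I 1 & forall f g, I (f * g) -> I f \/ radical I g].

Definition integral_over_ideal J f : Prop :=
  exists (r : nat) (a : nat -> S),
    [/\ (0 < r)%N,
        forall i, (1 <= i <= r)%N -> ideal_pow J i (a i)
      & f ^+ r + \sum_(1 <= i < r.+1) a i * f ^+ (r - i) = 0].

Definition ideal_integral I J : Prop :=
  forall f, I f -> integral_over_ideal J f.

End CommutativeAlgebra.

Section Graded.
Variables (k : fieldType) (n : nat).
Local Notation S := {mpoly k[n]}.
Implicit Types (I : S -> Prop) (f g : S).

Definition irrelevant : S -> Prop := ideal_gen (fun f => exists i : 'I_n, f = 'X_i).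

Definition homogeneous_ideal I : Prop :=
  is_ideal I /\ forall f, I f -> forall j, I (pihomog mdeg j f).

Definition m_primary I : Prop :=
  is_primary I /\ forall f, radical I f <-> irrelevant f.

Definition trunc_ideal I (t : nat) : S -> Prop :=
  ideal_gen (fun f => I f /\ exists2 j, (j <= t)%N & f \is j.-homog).

Definition asymptotic_gen_degree I (d : nat) : Prop :=
  ideal_integral I (trunc_ideal I d) /\
  forall t, ideal_integral I (trunc_ideal I t) -> (d <= t)%N.

Definition minimal_generating_set I (G : S -> Prop) : Prop :=
  [/\ forall g, G g -> exists j, g \is j.-homog,
      forall f, I f <-> ideal_gen G f
    & forall g, G g -> ~ ideal_gen (fun h => G h /\ h <> g) g].

Definition min_gen_degree I (j : nat) : Prop :=
  exists G g, [/\ minimal_generating_set I G, G g & g \is j.-homog].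

Definition max_gen_degree I (D : nat) : Prop :=
  min_gen_degree I D /\ forall j, min_gen_degree I j -> (j <= D)%N.

(* [d + b'] is the least degree greater than [d] of a minimal generator of
   [I]; [b' = None] stands for infinity. *)
Definition next_gen_degree I (d : nat) (b' : option nat) : Prop :=
  match b' with
  | Some c => [/\ (0 < c)%N, min_gen_degree I (d + c)
                & forall j, min_gen_degree I j -> (d < j)%N -> (d + c <= j)%N]
  | None => forall j, min_gen_degree I j -> (j <= d)%N
  end.

(* Free modules [F_i] of finite rank [rk i], whose [j]-th basis vector has
   degree [tw i j], i.e. [F_i] is the direct sum of the [S(- tw i j)].  Elements
   are row vectors; [diff i] is the map [F_(i+1) -> F_i], [v |-> v *m diff i], and
   [aug] is the augmentation [F_0 -> S].  Nothing forces [rk i = 0] for large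
   [i]: for minimal resolutions this is Hilbert's syzygy theorem.  Twists are
   natural numbers because ideals live in nonnegative degrees. *)
Record free_data := FreeData {
  rk : nat -> nat;
  tw : forall i, 'I_(rk i) -> nat;
  aug : 'cV[S]_(rk 0);
  diff : forall i, 'M[S]_(rk i.+1, rk i)
}.

(* [F] is a graded free resolution of the ideal [I], the maps having degree 0.
   For [diff], the condition says that a nonzero entry [(j, l)] is a form of
   degree [tw i.+1 j - tw i l], in the integers. *)
Definition graded_free_resolution (F : free_data) I : Prop :=
  [/\ forall j, aug F j 0 \is (tw j).-homog,
      forall i j l m, m \in msupp (diff F i j l) ->
        (mdeg m + tw l = tw j)%N,
      forall f, I f <-> exists v : 'rV[S]_(rk F 0), f = (v *m aug F) 0 0,
      forall v : 'rV[S]_(rk F 0),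
        v *m aug F = 0 <-> exists w, v = w *m diff F 0
    & forall i (v : 'rV[S]_(rk F i.+1)),
        v *m diff F i = 0 <-> exists w, v = w *m diff F i.+1].

Definition minimal_resolution (F : free_data) I : Prop :=
  graded_free_resolution F I /\
  forall i j l, irrelevant (diff F i j l).

(* [reg I = r], the regularity of [I] as a graded module: the maximum of
   [a - i] over the twists [S(-a)] occurring in the [i]-th module of a minimal
   graded free resolution of [I]. *)
Definition regularity I (r : int) : Prop :=
  exists F : free_data,
    [/\ minimal_resolution F I,
        exists i (j : 'I_(rk F i)), (tw j)%:Z - i%:Z = r
      & forall i (j : 'I_(rk F i)), (tw j)%:Z - i%:Z <= r].

End Graded.

(* [r / (d + b')], read as 0 when [b'] is infinite. *)
Definition reg_quotient (r : int) (d : nat) (b' : option nat) : rat :=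
  if b' is Some c then r%:~R / (d + c)%:R else 0.

(* Main.v *)
Require Import Defs.
From HB Require Import structures.
From mathcomp Require Import all_boot all_order all_algebra.
From mathcomp Require Import mpoly.
From mathcomp Require Import perm zify ring.
Set Implicit Arguments.
Unset Strict Implicit.
Unset Printing Implicit Defensive.
Import Order.TTheory GRing.Theory Num.Theory.
Local Open Scope ring_scope.

(** Write [reg Q] for regularity, [J] for the ideal generated by the forms of [I]
    of degree at most [d], and [S_t] for the space of forms of degree [t].

    For a homogeneous ideal [Q] of finite colength, [reg Q] is the least [s] with
    [S_s] contained in [Q] ([regularity_full], [full_regularity]).  Both halves
    compare a minimal resolution with the Koszul complex of the variables: Koszul
    homology is shifted from one syzygy module to the next, and the exactness that
    this needs comes, in characteristic 0, from Euler's formula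
    ([koszul_exact]).

    Put [R = reg I^m], so that [S_R] is contained in [I^m].  If an ideal [K] inside
    [I] is generated in degrees at most [D] and contains [S_(R + D)], then
    [S_(R + D) = S_R K_D] is contained in [I^(m+1)], whence [reg I^(m+1)] is at
    most [R + D] ([pow_succ_full]).  With [K = I] and [D = d + b] the inclusion is
    clear, and this is (1).  For the other two claims [K = J] and [D = d], and it
    must be seen that [S_(R + d)] is contained in [J].  As [I] is integral over [J],
    some power of each variable lies in [J], so [J] too has finite colength.

    For (2), [I] is contained in [J] plus the polynomials of order at least
    [d + b'], so the elements of [I^m] of degree less than [m (d + b')] lie in [J]
    ([pow_full_low]).  If [R < m (d + b')] then [S_R] lies in [J]; otherwise
    [R >= m (d + b') > reg J], and [S_R] lies in [J] again.  When [b'] is infinite,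
    [b = 0] and the claim is contained in (1).

    For the last claim, [J] contains all forms of degree greater than [n (d - 1)]
    ([trunc_full_of_powers]); since [m >= n], it is enough that [R >= d m].  If
    [R < d m], the same comparison with the ideal [A] generated by the forms of [I]
    of degree less than [d] puts [S_R] in [A].  Then [I S_R] is contained in
    [A S_R], and the determinant trick makes [I] integral over [A]
    ([integral_of_full]), against the minimality of [d]. *)

(** * Ideals given by predicates *)

Section Ideals.
Variable S : comNzRingType.
Implicit Types (I J A : S -> Prop) (f g : S).

Lemma ideal_sum I (T : Type) (s : seq T) (P : pred T) (F : T -> S) :
  is_ideal I -> (forall i, P i -> I (F i)) -> I (\sum_(i <- s | P i) F i).
Proof. by move=> [I0 ID _] FI; apply: (big_ind I). Qed.

Lemma ideal_opp I f : is_ideal I -> I f -> I (- f).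
Proof. by move=> [_ _ IM] If; rewrite -mulN1r; apply: IM. Qed.

Lemma ideal_mulr I f g : is_ideal I -> I f -> I (f * g).
Proof. by move=> [_ _ IM] If; rewrite mulrC; apply: IM. Qed.

Lemma ideal_genW A f : A f -> ideal_gen A f.
Proof.
move=> Af; exists 1%N, (fun=> 1), (fun=> f); split=> //.
by rewrite big_ord1 mul1r.
Qed.

Lemma ideal_gen_sub A I f :
  is_ideal I -> (forall g, A g -> I g) -> ideal_gen A f -> I f.
Proof.
move=> II AI [N [c [g [Ag ->]]]]; apply: ideal_sum => // i _.
by case: II => _ _; apply; apply/AI.
Qed.

Lemma is_ideal_gen A : is_ideal (ideal_gen A).
Proof.
split=> [|f g [N [c [u [Au ->]]]] [M [d [v [Av ->]]]]|f g [N [c [u [Au ->]]]]].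
- by exists 0%N, (fun=> 0), (fun=> 0); rewrite big_ord0; split=> // -[].
- exists (N + M)%N, (fun i => match split i with inl j => c j | inr j => d j end),
    (fun i => match split i with inl j => u j | inr j => v j end).
  split=> [i|]; first by case: (split i).
  rewrite big_split_ord; congr (_ + _); apply: eq_bigr => i _.
    by rewrite -[lshift _ _]/(unsplit (inl i)) unsplitK.
  by rewrite -[rshift _ _]/(unsplit (inr i)) unsplitK.
- exists N, (fun i => f * c i), u; split=> //.
  by rewrite mulr_sumr; apply: eq_bigr => i _; rewrite mulrA.
Qed.

Lemma ideal_pow_ideal I m : is_ideal (ideal_pow I m).
Proof. exact: is_ideal_gen. Qed.

Lemma ideal_pow_sub I m f : is_ideal I -> (0 < m)%N -> ideal_pow I m f -> I f.
Proof.
move=> II m0; apply: ideal_gen_sub => // g [u [Iu ->]].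
by case: m m0 u Iu => // m _ u Iu; rewrite big_ord_recl; apply: ideal_mulr.
Qed.

Lemma ideal_powX I m f : I f -> ideal_pow I m (f ^+ m).
Proof.
by move=> If; apply/ideal_genW; exists (fun=> f); rewrite prodr_const card_ord.
Qed.

Lemma ideal_powM I a b f g :
  ideal_pow I a f -> ideal_pow I b g -> ideal_pow I (a + b) (f * g).
Proof.
have II := ideal_pow_ideal I (a + b).
move=> [N [c [u [Iu ->]]]] [M [d [v [Iv ->]]]].
rewrite mulr_suml; apply: ideal_sum => // i _.
rewrite mulr_sumr; apply: ideal_sum => // j _.
rewrite mulrACA; case: (II) => _ _; apply; apply: ideal_genW.
have [s [Is ->]] := Iu i; have [t [It ->]] := Iv j.
exists (fun x => match split x with inl y => s y | inr y => t y end).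
split=> [x|]; first by case: (split x).
rewrite big_split_ord; congr (_ * _); apply: eq_bigr => x _.
  by rewrite -[lshift _ _]/(unsplit (inl x)) unsplitK.
by rewrite -[rshift _ _]/(unsplit (inr x)) unsplitK.
Qed.

Lemma ideal_pow1 I f : I f -> ideal_pow I 1 f.
Proof. by move=> If; rewrite -[f]expr1; apply: ideal_powX. Qed.

End Ideals.

(** * Monomial supports and homogeneous components *)

Section Supports.
Variables (k : fieldType) (n : nat).
Local Notation S := {mpoly k[n]}.
Implicit Types (f g : S) (m : 'X_{1..n}) (P : pred 'X_{1..n}).

Definition supported P f := {subset msupp f <= P}.

Lemma supported0 P : supported P 0.
Proof. by move=> m; rewrite msupp0. Qed.

Lemma supportedD P f g : supported P f -> supported P g -> supported P (f + g).
Proof. by move=> Pf Pg m /msuppD_le; rewrite mem_cat => /orP[/Pf|/Pg]. Qed.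

Lemma supportedN P f : supported P f -> supported P (- f).
Proof. by move=> Pf m; rewrite (perm_mem (msuppN _)) => /Pf. Qed.

Lemma supportedZ P c f : supported P f -> supported P (c *: f).
Proof. by move=> Pf m /msuppZ_le/Pf. Qed.

Lemma supported_sum P (T : Type) (s : seq T) (Q : pred T) (F : T -> S) :
  (forall i, Q i -> supported P (F i)) -> supported P (\sum_(i <- s | Q i) F i).
Proof.
move=> PF; apply: (big_ind (supported P)) => //;
  [exact: supported0 | exact: supportedD].
Qed.

Lemma supportedM P P1 P2 f g :
    (forall m1 m2, m1 \in msupp f -> m2 \in msupp g -> P1 m1 -> P2 m2 ->
       P (m1 + m2)%MM) ->
  supported P1 f -> supported P2 g -> supported P (f * g).
Proof.
move=> PM Pf Pg m /msuppM_le/allpairsP[[m1 m2] /= [m1f m2g ->]].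
by apply: PM => //; [apply: Pf | apply: Pg].
Qed.

Lemma supported_deriv P P1 i f :
  (forall m, P1 (m + U_(i))%MM -> P m) -> supported P1 f -> supported P f^`M(i).
Proof.
move=> PP Pf m; rewrite mcoeff_msupp mcoeff_mderiv => nz; apply/PP/Pf.
by rewrite mcoeff_msupp; apply: contraNneq nz => ->; rewrite mul0rn.
Qed.

(** Homogeneous components, but with an arbitrary set of monomials in place of
    a degree: twisted gradings and monomial ideals need other sets. *)
Definition mfilter P f : S := \sum_(m <- msupp f | P m) f@_m *: 'X_[m].

Lemma mfilterE P f m : (mfilter P f)@_m = if P m then f@_m else 0.
Proof.
rewrite raddf_sum /= big_mkcond /=.
under eq_bigr do rewrite mcoeffZ mcoeffX.
have [mf|mf] := boolP (m \in msupp f).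
  rewrite (bigD1_seq m) //= eqxx mulr1 big1 ?addr0 // => m' ne.
  by rewrite (negPf ne) mulr0 if_same.
rewrite (memN_msupp_eq0 mf) if_same big_seq big1 // => m' m'f.
case: eqP m'f => [->|_]; first by rewrite (negPf mf).
by rewrite mulr0 if_same.
Qed.

Lemma pihomog_mfilter d f : pihomog mdeg d f = mfilter [pred m | mdeg m == d] f.
Proof. by []. Qed.

Lemma supported_mfilter P f : supported P (mfilter P f).
Proof.
by move=> m; rewrite mcoeff_msupp mfilterE; case: ifP; rewrite ?eqxx.
Qed.

Lemma mfilter_id P f : supported P f -> mfilter P f = f.
Proof.
move=> Pf; apply/mpolyP => m; rewrite mfilterE; case: ifPn => // nP.
by apply/esym/memN_msupp_eq0; apply: contra nP => /Pf.
Qed.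

Lemma mfilter_splitE P f : f = mfilter P f + mfilter (predC P) f.
Proof.
by apply/mpolyP => m; rewrite mcoeffD !mfilterE /=; case: (P m);
  rewrite ?addr0 ?add0r.
Qed.

Lemma mfilterD P : {morph mfilter P : f g / f + g}.
Proof.
move=> f g; apply/mpolyP => m; rewrite mcoeffD !mfilterE mcoeffD.
by case: (P m); rewrite ?addr0.
Qed.

Lemma mfilter0 P : mfilter P 0 = 0.
Proof. by rewrite /mfilter msupp0 big_nil. Qed.

Lemma mfilter_eq0 P f : supported (predC P) f -> mfilter P f = 0.
Proof.
move=> Pf; apply/mpolyP => m; rewrite mfilterE mcoeff0; case: ifPn => // Pm.
by apply/memN_msupp_eq0/negP => /Pf; rewrite /= inE /= Pm.
Qed.

Lemma mfilter_sum P (T : Type) (s : seq T) (Q : pred T) (F : T -> S) :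
  mfilter P (\sum_(i <- s | Q i) F i) = \sum_(i <- s | Q i) mfilter P (F i).
Proof. exact: (big_morph _ (mfilterD P) (mfilter0 P)). Qed.

Lemma mfilterM P P1 f g :
    (forall m1 m2, m2 \in msupp g -> P (m1 + m2)%MM = P1 m1) ->
  mfilter P (f * g) = mfilter P1 f * g.
Proof.
move=> PE; rewrite {1}[f](mfilter_splitE P1) mulrDl mfilterD.
rewrite (mfilter_id (P := P)); last first.
  apply: (@supportedM _ P1 predT _ _ _ (@supported_mfilter _ _)) => //.
  by move=> m1 m2 _ m2g; rewrite (PE _ _ m2g).
rewrite [X in _ + X]mfilter_eq0 ?addr0 //.
apply: (@supportedM _ (predC P1) predT _ _ _ (@supported_mfilter _ _)) => //.
by move=> m1 m2 _ m2g; rewrite /= (PE _ _ m2g).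
Qed.

Lemma pihomogM_homog d e c g :
  g \is e.-homog ->
  pihomog mdeg d (c * g) = if (e <= d)%N then pihomog mdeg (d - e) c * g else 0.
Proof.
move=> /dhomog_mf hg; rewrite !pihomog_mfilter; case: leqP => led.
  apply: mfilterM => m1 m2 /hg /= m2e.
  by rewrite mdegD m2e -(eqn_add2r e (mdeg m1)) subnK.
apply: mfilter_eq0; apply: (@supportedM _ predT predT) => //.
by move=> m1 m2 _ /hg /= m2e _ _; rewrite /= mdegD m2e; lia.
Qed.

Lemma mpoly_ind_supp (P : S -> Prop) f :
    P 0 -> (forall g h, P g -> P h -> P (g + h)) ->
    (forall m c, m \in msupp f -> P (c *: 'X_[m])) ->
  P f.
Proof.
move=> P0 PD PX; rewrite [f]mpolyE big_seq.
by apply: (big_ind P) => // m mf; apply: PX.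
Qed.

Lemma mnm_split d e m :
  mdeg m = (d + e)%N -> exists m1 m2, [/\ mdeg m1 = d, mdeg m2 = e & m = (m1 + m2)%MM].
Proof.
elim: d m => [|d IH] m dm.
  by exists 0%MM, m; rewrite add0m mdeg0.
have [i mi] : exists i, m i != 0%N.
  apply/existsP; apply: contra_eqT dm; rewrite negb_exists => /forallP m0.
  suff -> : m = 0%MM by rewrite mdeg0.
  by apply/mnmP => i; rewrite mnm0E; apply/eqP; move: (m0 i); rewrite negbK.
have Um : (U_(i) <= m)%MM by rewrite lep1mP.
have [|m1 [m2 [d1 d2 E]]] := IH (m - U_(i))%MM.
  by have := dm; rewrite -{1}(submK Um) mdegD mdeg1; lia.
exists (U_(i) + m1)%MM, m2; split=> //; first by rewrite mdegD mdeg1 d1.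
by rewrite -addmA -E addmC submK.
Qed.

End Supports.

(** * Signed contraction and wedge operators *)

Section Exterior.
Variables (T : nat) (V : zmodType).
Implicit Types (B : {set 'I_T}) (c : {set 'I_T} -> V) (l i : 'I_T).
Implicit Types (G A : 'I_T -> {additive V -> V}).

Definition sg (s : bool) (v : V) : V := if s then - v else v.

Lemma sg0 s : sg s 0 = 0. Proof. by case: s; rewrite /= ?oppr0. Qed.

Lemma sgD s u v : sg s (u + v) = sg s u + sg s v.
Proof. by case: s; rewrite //= opprD. Qed.

Lemma sg_sum s (J : finType) (P : pred J) (F : J -> V) :
  sg s (\sum_(j | P j) F j) = \sum_(j | P j) sg s (F j).
Proof. by case: s; rewrite //= sumrN. Qed.

Lemma sgsg s t v : sg s (sg t v) = sg (s (+) t) v.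
Proof. by case: s t => [] []; rewrite //= opprK. Qed.

Lemma raddf_sg (f : {additive V -> V}) s v : f (sg s v) = sg s (f v).
Proof. by case: s; rewrite //= raddfN. Qed.

(** The sign with which the basis vector of index [l] moves past those of
    index in [B] to its place in increasing order. *)
Definition cross l B : bool := odd #|[set j in B | (j < l)%N]|.

Lemma crossU l i B : i \notin B -> cross l (i |: B) = cross l B (+) (i < l)%N.
Proof.
move=> iB; rewrite /cross; case: ltnP => il /=.
  have -> : [set j in i |: B | (j < l)%N] = i |: [set j in B | (j < l)%N].
    by apply/setP => j; rewrite !inE; case: eqP => // ->; rewrite il.
  by rewrite cardsU1 !inE (negPf iB) /= addbT.
rewrite addbF; congr (odd #|pred_of_set _|).
by apply/setP => j; rewrite !inE; case: eqP => // ->; rewrite ltnNge il /= andbF.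
Qed.

Lemma crossD l i B : i \in B -> cross l (B :\ i) = cross l B (+) (i < l)%N.
Proof.
move=> iB; rewrite -{2}(setD1K iB) crossU ?addbK //.
by rewrite !inE eqxx.
Qed.

Definition contr G c B : V :=
  \sum_(l | l \notin B) sg (cross l B) (G l (c (l |: B))).
Definition wedge A c B : V :=
  \sum_(l | l \in B) sg (cross l B) (A l (c (B :\ l))).

Lemma sum_antisym (F : 'I_T -> 'I_T -> V) :
    (forall l, F l l = 0) -> (forall l i, F i l = - F l i) ->
  \sum_l \sum_i F l i = 0.
Proof.
move=> F0 FN.
have -> : \sum_l \sum_i F l i =
    \sum_(l : 'I_T) \sum_(i : 'I_T) (if (l < i)%N then F l i else 0) +
    \sum_(l : 'I_T) \sum_(i : 'I_T) (if (i < l)%N then F l i else 0).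
  rewrite -big_split; apply: eq_bigr => l _; rewrite -big_split /=.
  apply: eq_bigr => i _; case: ltngtP => [_|_|E]; rewrite ?addr0 ?add0r //.
  by rewrite (val_inj E) F0.
rewrite [X in _ + X]exchange_big /= -big_split big1 //= => l _.
by rewrite -big_split big1 //= => i _; case: ifP; rewrite ?addr0 // FN addNr.
Qed.

(** Removing two indices in either order gives opposite signs, so the double sum
    is antisymmetric. *)
Lemma contr_contr G c B :
  (forall l i v, G l (G i v) = G i (G l v)) -> contr G (contr G c) B = 0.
Proof.
move=> GC.
pose F l i := if [&& l \notin B, i \notin B & i != l] then
  sg (cross l B (+) cross i B (+) (l < i)%N) (G l (G i (c (l |: (i |: B))))) else 0.
rewrite -[RHS](@sum_antisym F).
- rewrite /contr big_mkcond; apply: eq_bigr => l _.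
  case: ifPn => lB; last by rewrite big1 // => i _; rewrite /F (negPf lB).
  rewrite raddf_sum sg_sum big_mkcond; apply: eq_bigr => i _.
  rewrite /F lB /= in_setU1 negb_or andbC; case: ifP => // /andP[iB ne].
  by rewrite raddf_sg sgsg crossU // setUCA addbA.
- by move=> l; rewrite /F eqxx !andbF.
- move=> l i; rewrite /F eq_sym andbCA; case: ifP; rewrite ?oppr0 //.
  case/and3P=> _ _ ne; rewrite GC setUCA [cross i B (+) _]addbC.
  have -> : (i < l)%N = ~~ (l < i)%N.
    by move: ne; rewrite -val_eqE /=; lia.
  by rewrite addbN; case: (_ (+) _ (+) _); rewrite /= ?opprK.
Qed.

(** The canonical anticommutation relation: off the diagonal [l = i] the terms
    of the two composites carry opposite signs. *)
Lemma contr_wedge G A c B :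
    (forall l i v, l != i -> G l (A i v) = A i (G l v)) ->
  contr G (wedge A c) B + wedge A (contr G c) B =
    \sum_(l | l \notin B) G l (A l (c B)) + \sum_(l | l \in B) A l (G l (c B)).
Proof.
move=> GA.
pose F l i :=
  sg (cross l B (+) cross i B (+) (l < i)%N) (G l (A i (c (l |: (B :\ i))))).
have -> : contr G (wedge A c) B = \sum_(l | l \notin B) G l (A l (c B)) +
    \sum_(l | l \notin B) \sum_(i | i \in B) F l i.
  rewrite -big_split; apply: eq_bigr => l lB.
  rewrite /wedge (bigD1 l) ?setU11 //= raddfD /= crossU // ltnn addbF.
  rewrite setU1K // raddf_sg.
  rewrite sgD sgsg addbb /=; congr (_ + _).
  rewrite raddf_sum sg_sum; apply: eq_big => [i|i /andP[iB ne]].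
    by rewrite in_setU1; case: eqP => [->|]; rewrite ?(negPf lB) ?andbT ?andbF.
  rewrite raddf_sg sgsg crossU // addbA /F; congr (sg _ (G l (A i (c _)))).
  apply/setP => j; rewrite !inE; case: (j =P l) => [->|] //=.
  by rewrite andbT eq_sym.
have -> : wedge A (contr G c) B = \sum_(l | l \in B) A l (G l (c B)) +
    \sum_(i | i \in B) \sum_(l | l \notin B) - F l i.
  rewrite -big_split; apply: eq_bigr => i iB.
  rewrite /contr (bigD1 i) ?setD11 //= raddfD /= crossD // ltnn addbF.
  rewrite setD1K // raddf_sg.
  rewrite sgD sgsg addbb /=; congr (_ + _).
  rewrite raddf_sum sg_sum; apply: eq_big => [l|l /andP[lB ne]].
    by rewrite !inE; case: eqP => [->|]; rewrite ?iB ?andbT ?andbF.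
  rewrite raddf_sg sgsg crossD // /F -GA //.
  have -> : (i < l)%N = ~~ (l < i)%N.
    by move: ne; rewrite -val_eqE /=; lia.
  rewrite addbA addbN [cross i B (+) _]addbC.
  by case: (_ (+) _ (+) _); rewrite /= ?opprK.
rewrite [X in _ + (_ + X)]exchange_big /= addrACA -[RHS]addr0; congr (_ + _).
rewrite -big_split big1 //= => l _; rewrite -big_split big1 //= => i _.
by rewrite subrr.
Qed.

End Exterior.

(** * The Koszul complex of the variables *)

Section Koszul.
Variables (k : fieldType) (n : nat).
Hypothesis char0 : [pchar k] =i pred0.
Local Notation S := {mpoly k[n]}.
Implicit Types (f g : S) (B : {set 'I_n}).

Definition mulvar r (l : 'I_n) : {additive 'rV[S]_r -> 'rV[S]_r} :=
  ( *:%R 'X_l).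

(** The differential of the Koszul complex of the variables, a chain being the
    family of its coordinates on the products of basis vectors. *)
Definition kd r (c : {set 'I_n} -> 'rV[S]_r) := contr (@mulvar r) c.

Lemma scale_mpolyE (a : k) f :
  a *: f = \sum_(m <- msupp f) (a * f@_m) *: 'X_[m].
Proof.
rewrite {1}[f]mpolyE scaler_sumr.
by apply: eq_bigr => m _; rewrite scalerA.
Qed.

Lemma euler f :
  \sum_l 'X_l * f^`M(l) = \sum_(m <- msupp f) ((mdeg m)%:R * f@_m) *: 'X_[m].
Proof.
transitivity (\sum_(l : 'I_n) \sum_(m <- msupp f) ((m l)%:R * f@_m) *: 'X_[k, m]).
  apply: eq_bigr => l _; rewrite {1}[f]mpolyE raddf_sum mulr_sumr.
  apply: eq_bigr => m _; rewrite /= mderivZ mderivX -scalerAr -scalerAr.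
  rewrite scalerA mulrC -mpolyXD; case: (posnP (m l)) => [->|ml].
    by rewrite !mul0r !scale0r.
  by rewrite addmC submK // lep1mP -lt0n.
rewrite exchange_big; apply: eq_bigr => m _ /=.
by rewrite -scaler_suml -mulr_suml -natr_sum mdegE.
Qed.

(** The Koszul basis vector of index [B] is given degree [#|B|], so that [kd]
    preserves the internal degree [a]. *)
Definition chain r (tw : 'I_r -> nat) p a (c : {set 'I_n} -> 'rV[S]_r) : Prop :=
  (forall B, #|B| != p -> c B = 0) /\
  forall B j, supported [pred m | mdeg m + tw j + p == a]%N (c B 0 j).

Lemma supported_sg P s f : supported P f -> supported P (sg s f).
Proof. by case: s => //; apply: supportedN. Qed.

Lemma sg_mx r s (v : 'rV[S]_r) j : (sg s v) 0 j = sg s (v 0 j).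
Proof. by case: s; rewrite //= mxE. Qed.

Lemma kdE r (c : {set 'I_n} -> 'rV[S]_r) B j :
  kd c B 0 j = \sum_(l | l \notin B) sg (cross l B) ('X_l * c (l |: B) 0 j).
Proof. by rewrite summxE; apply: eq_bigr => l _; rewrite sg_mx mxE. Qed.

Lemma eq_kd r (c1 c2 : {set 'I_n} -> 'rV[S]_r) : c1 =1 c2 -> kd c1 =1 kd c2.
Proof. by move=> E B; apply: eq_bigr => l _; rewrite E. Qed.

Lemma kdB r (c1 c2 : {set 'I_n} -> 'rV[S]_r) B :
  kd (fun B => c1 B - c2 B) B = kd c1 B - kd c2 B.
Proof.
rewrite -sumrB; apply: eq_bigr => l _; rewrite raddfB.
by case: (cross l B); rewrite //= opprB addrC opprK.
Qed.

Lemma kd_mul r s (c : {set 'I_n} -> 'rV[S]_r) (D : 'M[S]_(r, s)) B :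
  kd (fun B => c B *m D) B = kd c B *m D.
Proof.
rewrite mulmx_suml; apply: eq_bigr => l _; rewrite /= scalemxAl.
by case: (cross l B); rewrite //= mulNmx.
Qed.

Lemma kd_kd r (c : {set 'I_n} -> 'rV[S]_r) B : kd (kd c) B = 0.
Proof. by apply: contr_contr => l i v /=; rewrite !scalerA mulrC. Qed.

Lemma kd_chain0 r tw a (c : {set 'I_n} -> 'rV[S]_r) B :
  chain tw 0 a c -> kd c B = 0.
Proof.
move=> [c0 _]; apply: big1 => l _; rewrite c0 ?raddf0 ?sg0 //.
by rewrite cards_eq0 -subset0; apply/subsetPn; exists l; rewrite ?setU11 ?inE.
Qed.

Lemma kd_chain r tw p a (c : {set 'I_n} -> 'rV[S]_r) :
  chain tw p.+1 a c -> chain tw p a (kd c).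
Proof.
move=> [c0 cd]; split=> [B|B j].
  move=> Bp; apply: big1 => l lB; rewrite c0 ?raddf0 ?sg0 //.
  by rewrite cardsU1 lB add1n eqSS.
rewrite kdE; apply: supported_sum => l _; apply: supported_sg.
apply: (@supportedM _ _ _ predT _ _ _ _ _ (cd (l |: B) j)) => // m1 m2.
move=> /mem_msuppXP <- _ _ /eqP /= <-.
by rewrite /= mdegD mdeg1 add1n !addSn addnS.
Qed.

Lemma chainB r tw p a (c1 c2 : {set 'I_n} -> 'rV[S]_r) :
  chain tw p a c1 -> chain tw p a c2 -> chain tw p a (fun B => c1 B - c2 B).
Proof.
move=> [c10 c1d] [c20 c2d]; split=> [B Bp|B j].
  by rewrite c10 // c20 // subr0.
by rewrite !mxE; apply: supportedD => //; apply: supportedN.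
Qed.

Definition mderivmx r (l : 'I_n) : {additive 'rV[S]_r -> 'rV[S]_r} :=
  map_mx (mderiv l).

Lemma char0_unit a : (0 < a)%N -> (a%:R : k) != 0.
Proof. by move=> a0; have /pcharf0P -> := char0; rewrite -lt0n. Qed.

(** The de Rham differential is a homotopy from zero to multiplication by the
    total degree, form degree included.  In characteristic 0 that number is
    invertible unless it is 0, which happens only for constants in [0]-chains. *)
Lemma koszul_exact r (tw : 'I_r -> nat) p a c :
    chain tw p a c -> (forall B, kd c B = 0) ->
    (0 < p)%N \/ (forall j, (c set0 0 j)@_0%MM = 0) ->
  exists2 c', chain tw p.+1 a c' & forall B, kd c' B = c B.
Proof.
move=> [c0 cd] kc cst; pose h := wedge (@mderivmx r) c.
have hE B j : h B 0 j = \sum_(l | l \in B) sg (cross l B) (c (B :\ l) 0 j)^`M(l).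
  by rewrite summxE; apply: eq_bigr => l _; rewrite sg_mx mxE.
have khE B j : kd h B 0 j = (a - tw j)%:R *: c B 0 j.
  have [Bp|Bp] := eqVneq #|B| p; last first.
    rewrite c0 // mxE scaler0 kdE big1 // => l lB.
    rewrite hE big1 ?mulr0 ?sg0 // => i; rewrite in_setU1 => iB.
    rewrite c0 ?mxE ?raddf0 ?sg0 //; apply: contraNneq Bp => E.
    by have := cardsD1 i (l |: B); rewrite E cardsU1 lB in_setU1 iB; lia.
  have GA l i (v : 'rV[S]_r) : l != i ->
      mulvar r l (mderivmx r i v) = mderivmx r i (mulvar r l v).
    move=> li; apply/rowP => x; rewrite /= !mxE mderivM mderivX mnm1E.
    by rewrite (negPf li) scale0r mul0r add0r.
  have := contr_wedge c B GA; rewrite -/h -/(kd h).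
  have -> : wedge (@mderivmx r) (contr (@mulvar r) c) B = 0.
    by apply: big1 => l _; rewrite [contr _ _ _]kc raddf0 sg0.
  rewrite addr0 => ->.
  rewrite mxE !summxE.
  (* The terms with [l] in [B] contribute [#|B|] more by the Leibniz rule; what
     remains is Euler's formula. *)
  have -> : \sum_(l in B) (mderivmx r l (mulvar r l (c B))) 0 j =
      p%:R *: c B 0 j + \sum_(l in B) (mulvar r l (mderivmx r l (c B))) 0 j.
    rewrite -Bp -sumr_const scaler_suml -big_split; apply: eq_bigr => l _ /=.
    rewrite !mxE mderivM mderivX mnm1E eqxx scale1r scale1r.
    have -> : (U_(l) - U_(l))%MM = 0%MM :> 'X_{1..n}.
      by apply/mnmP => x; rewrite mnmBE subnn mnm0E.
    by rewrite mpolyX0 mul1r.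
  rewrite addrCA [X in _ + X]addrC.
  have -> : \sum_(l in B) (mulvar r l (mderivmx r l (c B))) 0 j +
      \sum_(l | l \notin B) (mulvar r l (mderivmx r l (c B))) 0 j =
      \sum_l 'X_l * (c B 0 j)^`M(l).
    rewrite [RHS](bigID (mem B)) /=.
    by congr (_ + _); apply: eq_bigr => l _; rewrite /= !mxE.
  rewrite euler !scale_mpolyE -big_split /= !big_seq; apply: eq_bigr => m mc.
  rewrite -scalerDl -mulrDl -natrD; congr (_%:R * _ *: _).
  by have /eqP := cd B j m mc; rewrite /= => <-; lia.
(* Each coordinate has its own total degree, because of the twists. *)
pose c' B : 'rV[S]_r := \row_j ((a - tw j)%:R^-1 *: h B 0 j).
exists c'.
  split=> [B Bp|B j].
    apply/rowP => j; rewrite !mxE hE big1 ?scaler0 // => l lB.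
    rewrite c0 ?mxE ?raddf0 ?sg0 //; apply: contraNneq Bp => <-.
    by rewrite (cardsD1 l) lB.
  rewrite mxE hE; apply/supportedZ/supported_sum => l lB.
  apply/supported_sg; apply: supported_deriv (cd _ _) => m /=.
  by rewrite mdegD mdeg1 addn1 addSn addSn addnS.
move=> B; apply/rowP => j.
have -> : kd c' B 0 j = (a - tw j)%:R^-1 *: kd h B 0 j.
  rewrite !kdE scaler_sumr; apply: eq_bigr => l _; rewrite mxE -scalerAr.
  by case: (cross l B); rewrite //= scalerN.
rewrite khE scalerA; have [/char0_unit/mulVf ->|] := ltnP 0 (a - tw j).
  by rewrite scale1r.
rewrite leqn0 => /eqP aj; rewrite aj invr0 mul0r scale0r.
apply/esym/mpolyP => m; rewrite mcoeff0; apply/eqP/negPn/negP.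
rewrite -mcoeff_msupp => mc; have /eqP /= := cd B j m mc.
have [Bp|Bp] := eqVneq #|B| p; last first.
  by move: mc; rewrite c0 // mxE msupp0.
case: cst => [p0 E|cst E]; first by lia.
have p0 : p = 0%N by lia.
move: Bp mc; rewrite p0 => /eqP; rewrite cards_eq0 => /eqP ->.
have /eqP : mdeg m = 0%N by lia.
by rewrite mdeg_eq0 => /eqP ->; rewrite mcoeff_msupp cst eqxx.
Qed.

End Koszul.

(** * Regularity of ideals of finite colength *)

Section Full.
Variables (k : fieldType) (n : nat).
Local Notation S := {mpoly k[n]}.
Implicit Types (Q : S -> Prop) (f g : S).

Definition full Q t : Prop := forall f, f \is t.-homog -> Q f.

Lemma fullX Q t :
  is_ideal Q -> (forall m, mdeg m = t -> Q 'X_[m]) -> full Q t.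
Proof.
move=> QI QX f /dhomog_mf fh; have [Q0 QD QM] := QI.
apply: mpoly_ind_supp => // m c /fh mt; rewrite -mul_mpolyC; exact/QM/QX.
Qed.

Lemma full_leq Q s t : is_ideal Q -> (s <= t)%N -> full Q s -> full Q t.
Proof.
move=> QI st Qs; apply: fullX => // m mt; have [_ _ QM] := QI.
have [|m1 [m2 [d1 d2 ->]]] := @mnm_split n (t - s) s m; first by rewrite subnK.
by rewrite mpolyXD; apply/QM/Qs; rewrite dhomogX /= d2.
Qed.

End Full.

Section Resolution.
Variables (k : fieldType) (n : nat).
Hypothesis char0 : [pchar k] =i pred0.
Local Notation S := {mpoly k[n]}.
Variables (Q : S -> Prop) (F : free_data k n).
Hypothesis QI : is_ideal Q.
Hypothesis resF : minimal_resolution F Q.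

(** The resolution of [Q] continued by the augmentation is a resolution of
    [S / Q]; indexing by that longer complex makes the augmentation an ordinary
    differential. *)
Definition xrk i := if i is i'.+1 then rk F i' else 1%N.
Definition xtw i : 'I_(xrk i) -> nat :=
  match i with 0 => fun=> 0%N | i'.+1 => @tw k n F i' end.
Definition xd i : 'M[S]_(xrk i.+1, xrk i) :=
  match i with 0 => aug F | i'.+1 => diff F i' end.

Definition syz i (v : 'rV[S]_(xrk i)) := exists w, v = w *m xd i.

Lemma mcoeff0_mulX l (f : S) : ('X_l * f)@_0%MM = 0.
Proof.
apply: memN_msupp_eq0; apply/negP => /msuppM_le.
case/allpairsP=> -[m1 m2] /= [/mem_msuppXP <- _ /eqP].
by rewrite eq_sym mnmD_eq0 mnm1_eq0.
Qed.

Lemma irrelevant_mcoeff0 (f : S) : irrelevant f -> f@_0%MM = 0.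
Proof.
move=> [N [c [g [gX ->]]]]; rewrite raddf_sum big1 // => i _ /=.
by have [l ->] := gX i; rewrite mulrC mcoeff0_mulX.
Qed.

Lemma xd_homog i j l m :
  m \in msupp (xd i j l) -> (mdeg m + xtw l)%N = xtw (i := i.+1) j.
Proof.
have [[augh diffh _ _ _] _] := resF.
case: i j l => [|i] j l /=; last exact: diffh.
by rewrite (ord1 l) addn0; apply: dhomog_mf.
Qed.

Lemma xd_exact i (v : 'rV[S]_(xrk i.+1)) : v *m xd i = 0 <-> syz v.
Proof. by have [[_ _ _ ex0 exS] _] := resF; case: i v. Qed.

Lemma syz0 (v : 'rV[S]_(xrk 0)) : syz v <-> Q (v 0 0).
Proof.
have [[_ _ QE _ _] _] := resF; split=> [[w ->]|/QE[w vE]].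
  by apply/QE; exists w.
by exists w; apply/rowP => j; rewrite (ord1 j).
Qed.

Lemma syz_min i (v : 'rV[S]_(xrk i.+1)) j : syz v -> (v 0 j)@_0%MM = 0.
Proof.
have [_ irr] := resF => -[w ->]; rewrite mxE raddf_sum big1 // => l _.
apply: irrelevant_mcoeff0; case: (is_ideal_gen (fun f : S => exists i, f = 'X_i)).
by move=> _ _; apply; apply: irr.
Qed.

Lemma syz0r i : syz (0 : 'rV[S]_(xrk i)).
Proof. by exists 0; rewrite mul0mx. Qed.

(** Keeping the monomials of the expected degree turns any preimage into a
    homogeneous one. *)
Lemma chain_lift i p a (c : {set 'I_n} -> 'rV[S]_(xrk i)) :
    chain (@xtw i) p a c -> (forall B, syz (c B)) ->
  exists2 c' : {set 'I_n} -> 'rV[S]_(xrk i.+1),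
    chain (@xtw i.+1) p a c' & forall B, c B = c' B *m xd i.
Proof.
move=> [c0 cd] /fin_all_exists[w wE].
pose c' (B : {set 'I_n}) : 'rV[S]_(xrk i.+1) := \row_j
  (if #|B| == p then mfilter [pred m | mdeg m + xtw (i := i.+1) j + p == a]%N (w B 0 j)
   else 0).
exists c'.
  split=> [B /negPf Bp|B j]; first by apply/rowP => j; rewrite !mxE Bp.
  rewrite mxE; case: ifP => _; last exact: supported0.
  exact: supported_mfilter.
move=> B; have [Bp|Bp] := eqVneq #|B| p; last first.
  rewrite c0 //; suff -> : c' B = 0 by rewrite mul0mx.
  by apply/rowP => j; rewrite !mxE (negPf Bp).
apply/rowP => l; rewrite -[LHS](mfilter_id (cd B l)) {1}wE !mxE mfilter_sum.
apply: eq_bigr => j _; rewrite mxE Bp eqxx.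
by apply: mfilterM => m1 m2 /xd_homog /= <-; rewrite mdegD addnA.
Qed.

Lemma chain_mul_xd i p a (c : {set 'I_n} -> 'rV[S]_(xrk i.+1)) :
  chain (@xtw i.+1) p a c -> chain (@xtw i) p a (fun B => c B *m xd i).
Proof.
move=> [c0 cd]; split=> [B Bp|B l]; first by rewrite c0 ?mul0mx.
rewrite mxE; apply: supported_sum => j _.
apply: (@supportedM _ _ _ _ predT _ _ _ (cd B j)) => // m1 m2 _.
by move=> /xd_homog <- /eqP /= <- _; rewrite /= mdegD !addnA.
Qed.

Lemma kd_lift i p a (c : {set 'I_n} -> 'rV[S]_(xrk i)) c1 :
  (forall B, c B = c1 B *m xd i) -> (forall B, kd c B = 0) ->
  chain (@xtw i.+1) p a c1 -> forall B, syz (kd c1 B).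
Proof.
move=> cE kc _ B; apply/xd_exact; rewrite -kd_mul.
by rewrite -(eq_kd cE) kc.
Qed.

(** Koszul homology of [Q] vanishes in high degree because [Q] agrees there with
    the free module [S].  The connecting map of
    [0 -> Z_(i+1) -> F_i -> Z_i -> 0] carries the vanishing up the resolution, one
    homological degree down for each step. *)
Lemma syz_koszul_top t i p a (c : {set 'I_n} -> 'rV[S]_(xrk i)) :
    full Q t -> (p + t + i < a)%N ->
    chain (@xtw i) p a c -> (forall B, syz (c B)) -> (forall B, kd c B = 0) ->
  exists c', [/\ chain (@xtw i) p.+1 a c', forall B, syz (c' B)
               & forall B, kd c' B = c B].
Proof.
move=> Qt; elim: i p c => [|i IH] p c pa cc sc kc.
  have [c0 cd] := cc.
  have [|c' c'c c'E] := koszul_exact char0 cc kc.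
    right=> j; apply: memN_msupp_eq0; apply/negP => /cd/eqP /=.
    by rewrite mdeg0; lia.
  exists c'; split=> // B; apply/syz0; have [_ c'd] := c'c.
  apply: (full_leq QI _ Qt (t := a - p.+1)); first by lia.
  by apply/dhomogP => m /c'd /eqP /= <-; rewrite /= addn0 addnK.
have [|c' c'c c'E] := koszul_exact char0 cc kc.
  by right=> j; apply: syz_min.
(* The image of [c'] is a cycle on the previous syzygy module; its boundary
   there, lifted to [u], corrects [c'] into a chain of syzygies. *)
pose e B := c' B *m xd i.
have ec : chain (@xtw i) p.+1 a e := chain_mul_xd c'c.
have [|B|B|e' [e'c se' e'E]] := IH p.+1 e _ ec; first by lia.
- by exists (c' B).
- by rewrite kd_mul c'E; apply/xd_exact.
have [u uc uE] := chain_lift e'c se'.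
exists (fun B => c' B - kd u B); split.
- exact/chainB/kd_chain.
- by move=> B; apply/xd_exact; rewrite mulmxBl -kd_mul -(eq_kd uE) e'E subrr.
- by move=> B; rewrite kdB kd_kd subr0 c'E.
Qed.

(** If the degree of a basis vector is too high, its image is a [0]-cycle that
    bounds: modulo the irrelevant ideal the basis vector is then a syzygy, which
    minimality forbids. *)
Lemma full_twist t i (j : 'I_(rk F i)) : full Q t -> (tw j <= t + i)%N.
Proof.
move=> Qt; rewrite leqNgt; apply/negP => lt.
pose z : 'rV[S]_(xrk i) := row j (xd i).
pose c (B : {set 'I_n}) := if B == set0 then z else 0.
have cc : chain (@xtw i) 0 (tw j) c.
  split=> [B|B l]; first by rewrite cards_eq0 /c => /negPf ->.
  rewrite /c; case: eqP => _; last by rewrite mxE; apply: supported0.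
  by move=> m; rewrite mxE => /xd_homog /= mE; rewrite inE /= addn0 mE.
have [|B|B|c' [_ /fin_all_exists[w wE] c'E]] := syz_koszul_top Qt _ cc.
- by rewrite add0n.
- rewrite /c; case: eqP => _; last exact: syz0r.
  by exists (delta_mx 0 j); rewrite -rowE.
- exact: kd_chain0 cc.
have /xd_exact/(@syz_min _ _ j) :
    (delta_mx 0 j - kd w set0 : 'rV[S]_(xrk i.+1)) *m xd i = 0.
  rewrite mulmxBl -rowE -kd_mul -(eq_kd wE) c'E /c eqxx.
  by rewrite subrr.
rewrite mxE [X in _ + X]mxE mcoeffB [delta_mx _ _ _ _]mxE !eqxx mcoeff1 eqxx.
rewrite kdE raddf_sum big1 ?subr0 => [/eqP|l _]; first by rewrite oner_eq0.
by case: (cross l _); rewrite /= ?mcoeffN mcoeff0_mulX ?oppr0.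
Qed.

Lemma syz_cycle_lift i p a (c : {set 'I_n} -> 'rV[S]_(xrk i)) c1 :
    (forall B, c B = c1 B *m xd i) -> chain (@xtw i.+1) p a c1 ->
    (forall B, kd c1 B = 0) ->
    (0 < p)%N \/ (forall j, (c1 set0 0 j)@_0%MM = 0) ->
  exists c', [/\ chain (@xtw i) p.+1 a c', forall B, syz (c' B)
               & forall B, kd c' B = c B].
Proof.
move=> c1E c1c kc1 cst; have [c2 c2c c2E] := koszul_exact char0 c1c kc1 cst.
exists (fun B => c2 B *m xd i); split; first exact: chain_mul_xd.
  by move=> B; exists (c2 B).
by move=> B; rewrite kd_mul c2E c1E.
Qed.

(** Lifting a cycle along the resolution until it becomes a [0]-chain reaches
    the module in position [n] in a degree above all its twists. *)
Lemma syz_koszul_bottom s p i (c : {set 'I_n} -> 'rV[S]_(xrk i)) :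
    (forall i (j : 'I_(rk F i)), (tw j <= s + i)%N) -> (p + i).+1 = n ->
    chain (@xtw i) p (s + n) c -> (forall B, syz (c B)) ->
    (forall B, kd c B = 0) ->
  exists c', [/\ chain (@xtw i) p.+1 (s + n) c', forall B, syz (c' B)
               & forall B, kd c' B = c B].
Proof.
move=> twb; elim: p i c => [|p IH] i c pn cc sc kc;
  have [c1 c1c c1E] := chain_lift cc sc.
  apply: (syz_cycle_lift c1E c1c) => [B|]; first exact: kd_chain0 c1c.
  right=> j; apply: memN_msupp_eq0; apply/negP; have [_ c1d] := c1c.
  by move=> /c1d/eqP /=; rewrite mdeg0; have := twb i j; lia.
have [|B|B|c2 [c2c sc2 c2E]] := IH i.+1 (kd c1) _ (kd_chain c1c).
- by rewrite addnS.
- exact: kd_lift c1E kc c1c B.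
- exact: kd_kd.
(* [c2] consists of syzygies, so subtracting it leaves a lift of [c]. *)
apply: (@syz_cycle_lift _ _ _ _ (fun B => c1 B - c2 B)).
- by move=> B; rewrite mulmxBl -c1E; have /xd_exact -> := sc2 B; rewrite subr0.
- exact: chainB.
- by move=> B; rewrite kdB c2E subrr.
- by left.
Qed.

(** For a form [u] of degree [s] with every ['X_l * u] in [Q], viewed as an
    [n]-chain, [kd u] is a Koszul cycle on [Q]; it bounds only if [u] is in [Q]. *)
Lemma twist_full_pred s :
    (0 < n)%N -> (forall i (j : 'I_(rk F i)), (tw j <= s + i)%N) ->
  full Q s.+1 -> full Q s.
Proof.
move=> n0 twb Qs u us.
(* [u] is the coordinate on the top product of all basis vectors. *)
pose c (B : {set 'I_n}) : 'rV[S]_(xrk 0) := if B == setT then const_mx u else 0.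
have cc : chain (@xtw 0) n.-1.+1 (s + n) c.
  rewrite prednK //; split=> [B Bn|B l].
    rewrite /c; case: eqP => // BT.
    by move: Bn; rewrite BT cardsT card_ord eqxx.
  rewrite /c; case: eqP => _; rewrite mxE; last exact: supported0.
  by move=> m /(dhomog_mf us) /= ms; rewrite inE /= ms addn0.
have [|B|B|c' [c'c sc' c'E]] := syz_koszul_bottom twb _ (kd_chain cc).
- by rewrite addn0 prednK.
- apply/syz0; rewrite kdE; apply: (ideal_sum _ QI) => l _.
  suff Qc : Q ('X_l * c (l |: B) 0 0).
    by case: (cross l B) => //=; apply: ideal_opp.
  rewrite /c; case: eqP => _; last by rewrite mxE mulr0; case: QI.
  by rewrite mxE; apply: Qs; rewrite -add1n; apply: dhomogM; rewrite ?dhomogX /= ?mdeg1.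
- exact: kd_kd.
have ec := chainB cc c'c.
have [B||c'' [c''0 _] c''E] := koszul_exact char0 ec; last 1 first.
- have : c setT - c' setT = 0.
    rewrite -c''E; apply: big1 => l; by rewrite inE.
  move/subr0_eq => E; have /syz0 := sc' setT; rewrite -E.
  by rewrite /c eqxx mxE.
- by rewrite kdB c'E subrr.
- by left; rewrite prednK.
Qed.

(** Descending from a degree in which [Q] is everything, as finite colength
    provides. *)
Lemma twist_full s t :
    (0 < n)%N -> (forall i (j : 'I_(rk F i)), (tw j <= s + i)%N) ->
  full Q t -> full Q s.
Proof.
move=> n0 twb Qt; suff H d : full Q (s + d) -> full Q s.
  by apply: (H t); apply: (full_leq QI _ Qt); rewrite leq_addl.
elim: d => [|d IH]; rewrite ?addn0 // addnS => Q1; apply: IH.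
apply: (twist_full_pred n0 _ Q1) => i j.
by apply: leq_trans (twb i j) _; rewrite leq_add2r leq_addr.
Qed.

End Resolution.

Section Regularity.
Variables (k : fieldType) (n : nat).
Hypothesis char0 : [pchar k] =i pred0.
Local Notation S := {mpoly k[n]}.
Variables (Q : S -> Prop) (r : int) (t : nat).
Hypotheses (QI : is_ideal Q) (Qt : full Q t) (regQ : regularity Q r).

Lemma regularity_full s : (0 < n)%N -> r <= s%:Z -> full Q s.
Proof.
move=> n0 rs; have [F [resF _ twr]] := regQ.
apply: (twist_full char0 QI resF n0 _ Qt) => i j.
by have := le_trans (twr i j) rs; lia.
Qed.

Lemma full_regularity s : full Q s -> r <= s%:Z.
Proof.
move=> Qs; have [F [resF [i [j <-]] _]] := regQ.
by have := full_twist char0 QI resF j Qs; lia.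
Qed.

End Regularity.

(** * Truncations of homogeneous ideals *)

Section Truncation.
Variables (k : fieldType) (n : nat).
Local Notation S := {mpoly k[n]}.
Implicit Types (I A P : S -> Prop) (f g u : S).

(** A monomial of degree above the sum of the exponents is divisible by one of
    the given powers. *)
Lemma powers_full A :
  is_ideal A -> (forall l, exists N, A ('X_l ^+ N)) -> exists t, full A t.
Proof.
move=> AI /fin_all_exists[N AN]; exists (\sum_l N l).+1.
apply: fullX => // m mt; have [_ _ AM] := AI.
have [l ml] : exists l, (N l <= m l)%N.
  apply/existsP; apply: contraT => /existsPn Nm.
  suff : (mdeg m <= \sum_l N l)%N by rewrite mt ltnn.
  rewrite mdegE; apply: leq_sum => l _.
  by have := Nm l; rewrite -ltnNge => /ltnW.
have Um : (U_(l) *+ N l <= m)%MM.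
  by apply/mnm_lepP => i; rewrite mulmnE mnm1E; case: eqP => [<-|_]; rewrite ?mul1n.
by rewrite -(submK Um) mpolyXD -mpolyXn; apply: AM.
Qed.

Lemma trunc_is_ideal I t : is_ideal (trunc_ideal I t).
Proof. exact: is_ideal_gen. Qed.

Lemma trunc_sub I t f : is_ideal I -> trunc_ideal I t f -> I f.
Proof. by move=> II; apply: ideal_gen_sub => // g []. Qed.

Lemma trunc_homogeneous I t : homogeneous_ideal (trunc_ideal I t).
Proof.
have TI := trunc_is_ideal I t.
split=> // f [N [c [g [gA ->]]]] j; rewrite raddf_sum.
apply: ideal_sum => // i _; have [Ig [e et ge]] := gA i.
rewrite /= (pihomogM_homog _ _ ge); have [T0 _ TM] := TI.
by case: ifP => // _; apply/TM/ideal_genW; split=> //; exists e.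
Qed.

(** A coefficient of degree [R + (D - j)] in front of a generator of degree [j]
    factors through degree [R]: monomials split in every way. *)
Lemma trunc_mul I P R D f : is_ideal P ->
    (forall u g, u \is R.-homog -> trunc_ideal I D g -> P (u * g)) ->
  trunc_ideal I D f -> f \is (R + D)%N.-homog -> P f.
Proof.
move=> PI PM [N [c [g [gA ->]]]] fh; rewrite -(pihomog_dE fh) raddf_sum.
apply: ideal_sum => // i _; have [Ig [e eD ge]] := gA i.
rewrite /= (pihomogM_homog _ _ ge); have [P0 PD PS] := PI.
case: ifP => // _; set w := pihomog _ _ _.
have /dhomog_mf wh : w \is (R + D - e)%N.-homog := pihomogP _ _ _.
apply: (@mpoly_ind_supp _ _ (fun w => P (w * g i))).
- by rewrite mul0r.
- by move=> x y Px Py; rewrite mulrDl; apply: PD.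
move=> m a /wh /= md; have [|m1 [m2 [d1 d2 ->]]] := @mnm_split n R (D - e) m.
  by rewrite md addnBA.
rewrite mpolyXD -mul_mpolyC mulrA -mulrA; apply: PM.
  by rewrite mul_mpolyC rpredZ // dhomogX /= d1.
have [_ _ TM] := trunc_is_ideal I D.
by apply/TM/ideal_genW; split=> //; exists e.
Qed.

Lemma pow_succ_full I R D m : is_ideal I ->
    full (ideal_pow I m) R -> full (trunc_ideal I D) (R + D) ->
  full (ideal_pow I m.+1) (R + D).
Proof.
move=> II IR JR f fh; apply: (trunc_mul _ _ (JR f fh) fh).
  exact: ideal_pow_ideal.
move=> u g uh /(trunc_sub II)/ideal_pow1 Ig; rewrite -addn1.
by apply: ideal_powM Ig; apply: IR.
Qed.

(** The sum of [A] and the [c]-th power of the irrelevant ideal, the latter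
    described by the orders of its elements. *)
Definition add_order A c f : Prop :=
  exists2 a, A a & supported [pred m | c <= mdeg m]%N (f - a).

Lemma add_order_ideal A c : is_ideal A -> is_ideal (add_order A c).
Proof.
move=> AI; have [A0 AD AM] := AI; split.
- by exists 0 => //; rewrite subrr; apply: supported0.
- move=> f g [a Aa fa] [b Ab gb]; exists (a + b); first exact: AD.
  by rewrite opprD addrACA; apply: supportedD.
- move=> f g [a Aa ga]; exists (f * a); first exact: AM.
  rewrite -mulrBr; apply: (@supportedM _ _ _ predT _ _ _ _ _ ga) => //.
  by move=> m1 m2 _ _ _ /= cm; rewrite mdegD; apply: leq_trans cm (leq_addl _ _).
Qed.

Lemma add_orderM A c e f g : is_ideal A ->
  add_order A c f -> add_order A e g -> add_order A (c + e) (f * g).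
Proof.
move=> AI [a Aa fa] [b Ab gb]; exists (a * g + (f - a) * b).
  by have [_ AD AM] := AI; apply: AD; [apply: ideal_mulr | apply: AM].
have -> : f * g - (a * g + (f - a) * b) = (f - a) * (g - b).
  by rewrite opprD addrA -mulrBl -mulrBr.
apply: (supportedM _ fa gb) => m1 m2 _ _ /= cm em.
by rewrite mdegD; apply: leq_add.
Qed.

Lemma pow_add_order I A c m f : is_ideal A ->
  (forall f, I f -> add_order A c f) -> ideal_pow I m f -> add_order A (c * m) f.
Proof.
move=> AI IA; apply: ideal_gen_sub => [|g [u [Iu ->]]].
  exact: add_order_ideal.
elim: m u Iu => [|m IH] u Iu.
  rewrite muln0; exists 0; first by case: AI.
  by move=> x _.
by rewrite big_ord_recl mulnS; apply: add_orderM; [|apply: IA|apply: IH].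
Qed.

Lemma add_order_low A c R f : homogeneous_ideal A -> (R < c)%N ->
  add_order A c f -> f \is R.-homog -> A f.
Proof.
move=> [AI AH] Rc [a Aa fa] /pihomog_dE <-.
rewrite -[f](subrK a) pihomogD pihomog_mfilter mfilter_eq0 ?add0r; first exact: AH.
by move=> m /fa /= cm; rewrite inE /= gtn_eqF // (leq_trans Rc).
Qed.

(** Below degree [c * m], the summand of order at least [c * m] is invisible. *)
Lemma pow_full_low I A c m R : homogeneous_ideal A ->
    (forall f, I f -> add_order A c f) -> (R < c * m)%N ->
  full (ideal_pow I m) R -> full A R.
Proof.
move=> AH IA Rc IR f fh; apply: (add_order_low AH Rc) (fh).
by case: AH => AI _; apply: pow_add_order (IR _ fh).
Qed.

Lemma homogeneous_add_order I c f : homogeneous_ideal I -> (0 < c)%N ->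
  I f -> add_order (trunc_ideal I c.-1) c f.
Proof.
move=> [II IH] c0 If; exists (mfilter [pred m | mdeg m < c]%N f).
  set a := mfilter _ f; rewrite (@pihomog_partitionE _ _ mdeg (msize a) a) //.
  have TI := trunc_is_ideal I c.-1.
  apply: ideal_sum => // j _; have [jc|cj] := ltnP j c.
    apply: ideal_genW; split; last by exists j; [lia | exact: pihomogP].
    suff -> : pihomog mdeg j a = pihomog mdeg j f by apply: IH.
    apply/mpolyP => m; rewrite !pihomog_mfilter !mfilterE /=.
    by case: eqP => // ->; rewrite jc.
  suff -> : pihomog mdeg j a = 0 by case: TI.
  rewrite pihomog_mfilter mfilter_eq0 // => m /supported_mfilter /= mc.
  by rewrite inE /= neq_ltn (leq_trans mc cj).
move=> m; rewrite mcoeff_msupp mcoeffB mfilterE /= inE /=.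
by case: ltnP => //; rewrite subrr eqxx.
Qed.

End Truncation.

(** * Forms of high degree in an ideal generated in low degrees *)

Section CommonGenerators.
Variable S : comNzRingType.

Lemma common_generators (A : S -> Prop) (J : eqType) (s : seq J) (F : J -> S) :
    (forall l, ideal_gen A (F l)) ->
  exists T (g : 'I_T -> S), (forall j, A (g j)) /\
    forall l, l \in s -> exists a : 'I_T -> S, F l = \sum_j a j * g j.
Proof.
move=> AF; elim: s => [|x s [T [g [Ag gF]]]].
  by exists 0%N, (fun=> 0); split=> // -[].
have [T' [c [g' [Ag' FE]]]] := AF x.
exists (T' + T)%N, (fun i => match split i with inl j => g' j | inr j => g j end).
split=> [i|l]; first by case: (split i).
rewrite inE => /predU1P[->|/gF[a aE]].
  exists (fun i => match split i with inl j => c j | inr j => 0 end).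
  rewrite big_split_ord FE -[LHS]addr0; congr (_ + _).
    apply: eq_bigr => i _.
    by rewrite -[lshift _ _]/(unsplit (inl i)) unsplitK.
  apply/esym/big1 => i _.
  by rewrite -[rshift _ _]/(unsplit (inr i)) unsplitK mul0r.
exists (fun i => match split i with inl j => 0 | inr j => a j end).
rewrite big_split_ord aE -[LHS]add0r; congr (_ + _).
  apply/esym/big1 => i _.
  by rewrite -[lshift _ _]/(unsplit (inl i)) unsplitK mul0r.
apply: eq_bigr => i _.
by rewrite -[rshift _ _]/(unsplit (inr i)) unsplitK.
Qed.

End CommonGenerators.

Section Macaulay.
Variables (k : fieldType) (n : nat).
Local Notation S := {mpoly k[n]}.
Variables (T N d t : nat) (g : 'I_T -> S) (a : 'I_n -> 'I_T -> S) (u : S).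
Hypothesis aE : forall l, 'X_l ^+ N = \sum_j a l j * g j.

Definition mulby (h : 'I_T -> S) j : {additive S -> S} := (h j \*o idfun).

(** [a_l1 /\ ... /\ a_ls /\ u] in the exterior algebra on the generators [g]; its
    coordinates are [u] times the minors of [a]. *)
Definition wedges (s : seq 'I_n) : {set 'I_T} -> S :=
  foldr (fun l w => wedge (mulby (a l)) w) (fun B => if B == set0 then u else 0) s.

(** A monomial ideal, here that of some [N]-th powers, enters only through the set
    of its monomials. *)
Definition powers_of (s : seq 'I_n) : pred 'X_{1..n} :=
  [pred m : 'X_{1..n} | has (fun l => N <= m l)%N s].

Lemma supported_mull s (f h : S) :
  supported (powers_of s) h -> supported (powers_of s) (f * h).
Proof.
apply: (@supportedM _ _ _ predT) => // m1 m2 _ _ _ /hasP[l ls Nl].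
apply/hasP; exists l => //; rewrite mnmDE; exact: leq_trans Nl (leq_addl _ _).
Qed.

Lemma contr_wedges l s B :
  contr (mulby g) (wedges (l :: s)) B =
    'X_l ^+ N * wedges s B - wedge (mulby (a l)) (contr (mulby g) (wedges s)) B.
Proof.
rewrite /= -/(wedges s); apply/eqP; rewrite eq_sym subr_eq eq_sym; apply/eqP.
rewrite contr_wedge => [|i j v _]; last by rewrite /= mulrCA.
rewrite aE mulr_suml [RHS](bigID (mem B)) /= addrC.
by congr (_ + _); apply: eq_bigr => j _ /=; rewrite mulrA // [_ * a l j]mulrC.
Qed.

Lemma contr_wedges_supported s B : supported (powers_of s) (contr (mulby g) (wedges s) B).
Proof.
elim: s B => [|l s IH] B.
  rewrite /contr big1 => [|j _]; first exact: supported0.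
  rewrite /wedges /= -subset0; case: ifP; rewrite ?mulr0 ?sg0 //.
  by rewrite subUset sub1set inE.
rewrite contr_wedges; apply: supportedD.
  rewrite mpolyXn mulrC; apply: (@supportedM _ _ _ predT predT) => //.
  move=> m1 m2 _ /mem_msuppXP <- _ _; apply/hasP; exists l; rewrite ?mem_head //.
  by rewrite mnmDE mulmnE mnm1E eqxx mul1n leq_addl.
apply/supportedN/supported_sum => j _; apply/supported_sg/supported_mull.
by move=> m /IH ms; apply/orP; right.
Qed.

(** If [a_l /\ w] bounds modulo the powers of the variables in [l :: s], then
    contracting with [g] shows that ['X_l ^+ N * (w - delta theta)] lies in the
    monomial ideal of [s], on which ['X_l ^+ N] is regular. *)
Lemma wedges_descent s : uniq s ->
    (exists eta, forall B,
       supported (powers_of s) (wedges s B - contr (mulby g) eta B)) ->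
  exists eta, u = contr (mulby g) eta set0.
Proof.
elim: s => [_ [eta H]|l s IH /= /andP[ls us] [eta H]].
  exists eta; apply/eqP; rewrite -subr_eq0; apply/eqP/mpolyP => m.
  rewrite mcoeff0; apply/memN_msupp_eq0/negP.
  by have := H set0 m; rewrite /wedges /= eqxx => h /h.
apply: (IH us).
pose tau B := wedges (l :: s) B - contr (mulby g) eta B.
pose P := [pred m : 'X_{1..n} | N <= m l]%N.
pose theta B : S := \sum_(m <- msupp (tau B) | P m) (tau B)@_m *: 'X_[m - U_(l) *+ N].
have thE B : 'X_l ^+ N * theta B = mfilter P (tau B).
  rewrite mulr_sumr; apply: eq_bigr => m /= Nm.
  rewrite -scalerAr mpolyXn -mpolyXD addmC submK //; apply/mnm_lepP => i.
  by rewrite mulmnE mnm1E; case: eqP => [<-|_]; rewrite ?mul1n.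
exists theta => B; set z := wedges s B - _.
suff zs : supported (powers_of s) ('X_l ^+ N * z).
  move=> m mz; have : (m + U_(l) *+ N)%MM \in msupp ('X_l ^+ N * z).
    by rewrite mcoeff_msupp mpolyXn mulrC addmC mcoeffMX -mcoeff_msupp.
  move/zs/hasP => [i si Ni]; apply/hasP; exists i => //.
  move: Ni; rewrite mnmDE mulmnE mnm1E; case: eqP => [li|_]; last by rewrite mul0n addn0.
  by move: ls; rewrite li si.
have tauE C : tau C = 'X_l ^+ N * theta C + mfilter (predC P) (tau C).
  by rewrite thE -mfilter_splitE.
have taus C : supported (powers_of s) (mfilter (predC P) (tau C)).
  move=> m; rewrite mcoeff_msupp mfilterE; case: ifP => [nP|]; last by rewrite eqxx.
  rewrite -mcoeff_msupp => /(H C); rewrite /= inE /=.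
  by move: nP; rewrite /= => /negPf ->.
have dtau : contr (mulby g) tau B = 'X_l ^+ N * wedges s B -
    wedge (mulby (a l)) (contr (mulby g) (wedges s)) B.
  rewrite -contr_wedges -[RHS]subr0.
  rewrite -(contr_contr (G := mulby g) eta B) => [|i j v]; last by rewrite /= mulrCA.
  rewrite -sumrB; apply: eq_bigr => j _; rewrite raddfB.
  by case: (cross j B); rewrite //= opprB addrC opprK.
have -> : 'X_l ^+ N * z = wedge (mulby (a l)) (contr (mulby g) (wedges s)) B +
    contr (mulby g) (fun C => mfilter (predC P) (tau C)) B.
  rewrite mulrBr -[X in X - _](subrK (wedge (mulby (a l)) (contr (mulby g) (wedges s)) B)).
  rewrite -dtau -addrA addrCA; congr (_ + _).
  rewrite mulr_sumr -sumrB; apply: eq_bigr => j _; rewrite {1}tauE raddfD /=.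
  case: (cross j B); rewrite /= ?mulrN mulrCA; last by rewrite addrC addKr.
  by rewrite opprK opprD addrC addNKr.
apply: supportedD; apply: supported_sum => j _; apply/supported_sg/supported_mull => //.
  exact: contr_wedges_supported.
exact: taus.
Qed.

Hypothesis u_order : supported [pred m | t <= mdeg m]%N u.
Hypothesis a_order : forall l j, supported [pred m | N - d <= mdeg m]%N (a l j).

(** The minors of the matrix [a] have high order; this is what makes them fall into
    the monomial ideal of all powers. *)
Lemma wedges_order s B :
  supported [pred m | t + size s * (N - d) <= mdeg m]%N (wedges s B).
Proof.
elim: s B => [|l s IH] B.
  by rewrite /wedges /=; case: ifP => _; [rewrite addn0 | apply: supported0].
apply: supported_sum => j _; apply: supported_sg.

apply: (supportedM _ (@a_order l j) (IH (B :\ j))) => m1 m2 _ _ /= h1 h2.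
by rewrite mdegD mulSn addnCA leq_add.
Qed.

(** All monomials of degree above [n (N - 1)] lie in the ideal of the [N]-th powers,
    so the full wedge product vanishes modulo it, and descent applies. *)
Lemma contr_of_degree : (0 < N)%N -> (d <= N)%N -> (n * d < t + n)%N ->
  exists eta, u = contr (mulby g) eta set0.
Proof.
move=> N0 dN nd; apply: (wedges_descent (enum_uniq 'I_n)); exists (fun=> 0) => B.
rewrite [contr _ _ _]big1 ?subr0 => [|j _]; last by rewrite raddf0 sg0.
move=> m /wedges_order /=; rewrite size_enum_ord => mdeg_lb.
apply/hasP; suff [l Nl] : exists l, (N <= m l)%N by exists l; rewrite ?mem_enum.
apply/existsP; apply: contraT => /existsPn mN.
have : (mdeg m <= \sum_(l < n) (N - 1))%N.
  by rewrite mdegE; apply: leq_sum => l _; have := mN l; lia.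
rewrite sum_nat_const card_ord mulnBr muln1; move: mdeg_lb; rewrite mulnBr inE /=.
by have := leq_mul (leqnn n) dN; have := leq_mul (leqnn n) N0; lia.
Qed.

End Macaulay.

Section MacaulayBound.
Variables (k : fieldType) (n : nat).
Local Notation S := {mpoly k[n]}.

(** Macaulay's bound for the socle degree of a complete intersection of [n] forms
    of degree [d].  The powers of the variables play the regular sequence;
    expressing them through all the generators at once spares the choice of a
    complete intersection inside the ideal. *)
Lemma trunc_full_of_powers (I : S -> Prop) d t :
    (forall l, exists N, trunc_ideal I d ('X_l ^+ N)) -> (n * d < t + n)%N ->
  full (trunc_ideal I d) t.
Proof.
move=> /fin_all_exists[N0 IN0] nd u ut.
have TI := trunc_is_ideal I d.
(* One exponent for all variables, positive and at least [d]. *)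
pose N := (d + (\sum_l N0 l).+1)%N.
have IN l : trunc_ideal I d ('X_l ^+ N).
  have N0N : (N0 l <= N)%N by rewrite /N (bigD1 l) //=; lia.
  by have [_ _ TM] := TI; rewrite -(subnK N0N) exprD; apply/TM/IN0.
have [T [g [Ag gE]]] := common_generators (index_enum 'I_n) IN.
have /fin_all_exists[a0 a0E] l : exists a : 'I_T -> S, 'X_l ^+ N = \sum_j a j * g j.
  by apply: gE; apply: mem_index_enum.
have /fin_all_exists2[e ed ge] j : exists2 e, (e <= d)%N & g j \is e.-homog.
  by case: (Ag j).
pose a l j := if (e j <= N)%N then pihomog mdeg (N - e j) (a0 l j) else 0.
have aE l : 'X_l ^+ N = \sum_j a l j * g j.
  have XN : ('X_l : S) ^+ N \is N.-homog.
    by rewrite -[N in N.-homog]mul1n; apply: dhomogMn; rewrite dhomogX /= mdeg1.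
  rewrite -(pihomog_dE XN) a0E raddf_sum; apply: eq_bigr => j _.
  by rewrite /= (pihomogM_homog _ _ (ge j)) /a; case: ifP; rewrite ?mul0r.
have [| | | | |eta ->] := @contr_of_degree k n T N d t g a u aE.
- by move=> m /(dhomog_mf ut) /= mt; rewrite inE /= mt.
- move=> l j; rewrite /a; case: ifP => _; last exact: supported0.
  move=> m /(dhomog_mf (pihomogP _ _ _)) /= mE.
  by rewrite inE /= mE; apply: leq_sub2l.
- by rewrite /N addnS.
- by rewrite /N leq_addr.
- by [].
have [_ _ TM] := TI; apply: (ideal_sum _ TI) => l _.
suff Tl : trunc_ideal I d (g l * eta (l |: set0)).
  by case: (cross l _) => //=; apply: ideal_opp.
by rewrite mulrC; apply/TM/ideal_genW.
Qed.

End MacaulayBound.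

(** * Integral dependence *)

Section Integral.
Variable S : idomainType.
Implicit Types (A : S -> Prop) (p q : {poly S}).

Lemma integral_power A f :
  is_ideal A -> integral_over_ideal A f -> exists N, A (f ^+ N).
Proof.
move=> AI [r [a [r0 Aa E]]]; exists r.
have -> : f ^+ r = - \sum_(1 <= i < r.+1) a i * f ^+ (r - i).
  by apply/eqP; rewrite -addr_eq0 E.
apply: ideal_opp => //; rewrite big_nat; apply: ideal_sum => // i /andP[i1 ir].
by apply: ideal_mulr => //; apply: ideal_pow_sub (Aa _ _); rewrite ?i1.
Qed.

Lemma ideal_pow0 A f : ideal_pow A 0 f.
Proof.
have [_ _ PM] := ideal_pow_ideal A 0; rewrite -[f]mulr1.
by apply/PM/ideal_genW; exists (fun=> 0); split; [case|rewrite big_ord0].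
Qed.

Lemma ideal_pow_leq A a b f : (a <= b)%N -> ideal_pow A b f -> ideal_pow A a f.
Proof.
move=> /subnKC <-; apply: ideal_gen_sub => [|g [u [Au ->]]].
  exact: ideal_pow_ideal.
rewrite big_split_ord; apply: ideal_mulr; first exact: ideal_pow_ideal.
by apply: ideal_genW; exists (fun i => u (lshift _ i)); split.
Qed.

(** The polynomials homogeneous of degree [s] when ['X] has degree 1 and the
    elements of [A^i] have degree [i]; for [j > s] the truncated exponent is 0 and
    there is no condition. *)
Definition adic_weight A s p : Prop := forall j, ideal_pow A (s - j) p`_j.


Lemma adic_weight1 A p : A p`_0 -> adic_weight A 1 p.
Proof.
move=> Ap [|j]; first exact: ideal_pow1.
by rewrite subSS sub0n; apply: ideal_pow0.
Qed.

Lemma adic_weightM A s t p q :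
  adic_weight A s p -> adic_weight A t q -> adic_weight A (s + t) (p * q).
Proof.
move=> Ap Aq j; rewrite coefM; apply: ideal_sum => [|i _].
  exact: ideal_pow_ideal.
apply: ideal_pow_leq (ideal_powM (Ap _) (Aq _)).
by have := ltn_ord i; lia.
Qed.

Lemma char_poly_adic A (q : nat) (M : 'M[S]_q) :
  is_ideal A -> (forall i j, A (M i j)) -> adic_weight A q (char_poly M).
Proof.
move=> AI AM; have [A0 _ _] := AI.
rewrite /char_poly /determinant => j; rewrite coef_sum.
have PI := ideal_pow_ideal A (q - j).
apply: ideal_sum => // s _.
suff w : adic_weight A q (\prod_i char_poly_mx M i (s i)).
  case: (odd_perm s); last by rewrite expr0 mul1r; apply: w.
  by rewrite expr1 mulN1r coefN; apply: ideal_opp; last apply: w.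
rewrite -[X in adic_weight A X]card_ord -sum1_card.
apply: (big_ind2 (adic_weight A)).
- by move=> i; apply: ideal_pow0.
- by move=> s1 p1 s2 p2; apply: adic_weightM.
move=> i _; apply: adic_weight1; rewrite !mxE coefB coefMn coefX mul0rn sub0r coefC /=.
by apply: ideal_opp => //; apply: AM.
Qed.

(** The determinant trick, the coefficients of the characteristic polynomial
    being tracked in the powers of [A]. *)
Lemma integral_of_module A (q : nat) (v : 'I_q -> S) f i0 : is_ideal A -> v i0 != 0 ->
    (forall i, exists2 a : 'I_q -> S,
       forall j, A (a j) & f * v i = \sum_j a j * v j) ->
  integral_over_ideal A f.
Proof.
move=> AI v0 /fin_all_exists2[a Aa aE].
pose M : 'M[S]_q := \matrix_(i, j) a i j.
pose p := char_poly M.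
have pw : adic_weight A q p by apply: char_poly_adic => // i j; rewrite mxE.
have pf : p.[f] = 0.
  have -> : p.[f] = \det (f%:M - M).
    rewrite -horner_evalE -det_map_mx; congr (\det _); apply/matrixP => i j.
    rewrite !mxE /= horner_evalE hornerD hornerN hornerC hornerMn hornerX.
    by [].
  apply/eqP; have : \det (f%:M - M) *: (\col_i v i) = 0 :> 'cV_q.
    rewrite -mul_scalar_mx -mul_adj_mx -mulmxA.
    suff -> : (f%:M - M) *m (\col_i v i) = 0 by rewrite mulmx0.
    apply/colP => i; rewrite mulmxBl mul_scalar_mx !mxE aE -sumrB big1 // => j _.
    by rewrite !mxE subrr.
  move/colP/(_ i0)/eqP; rewrite !mxE mulf_eq0 (negPf v0) orbF.
  by [].
have q0 : (0 < q)%N by apply: leq_ltn_trans (ltn_ord i0).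
exists q, (fun i => p`_(q - i)); split=> //.
  move=> i /andP[_ iq]; have := pw (q - i)%N; by rewrite subKn.
rewrite -[RHS]pf horner_coef size_char_poly.
rewrite big_ord_recr /=.
have := char_poly_monic M; rewrite monicE /lead_coef size_char_poly => /eqP ->.
rewrite mul1r addrC; congr (_ + _).
rewrite big_add1 /= big_mkord (reindex_inj rev_ord_inj); apply: eq_bigr => i _ /=.
by rewrite subnSK // subKn // ltnW.
Qed.

End Integral.

Section GeneratingDegree.
Variables (k : fieldType) (n : nat).
Local Notation S := {mpoly k[n]}.

(** Multiplication by [I] sends the forms of degree [R] into their span with
    coefficients in the truncation, so [I] is integral over the truncation. *)
Lemma integral_of_full (I : S -> Prop) d R : homogeneous_ideal I ->
    (0 < n)%N -> (0 < d)%N -> full (trunc_ideal I d.-1) R ->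
  ideal_integral I (trunc_ideal I d.-1).
Proof.
move=> IH n0 d0 AR f If; set A := trunc_ideal I d.-1.
have AI : is_ideal A := is_ideal_gen _.
pose X : finType := 'X_{1..n < R.+1}.
pose v (i : 'I_#|X|) : S :=
  if mdeg (enum_val i : 'X_{1..n < R.+1}) == R then 'X_[(enum_val i : 'X_{1..n < R.+1})] else 0.
pose P h := exists2 a : 'I_#|X| -> S, forall j, A (a j) & h = \sum_j a j * v j.
have PI : is_ideal P.
  have [A0 AD AM] := AI; split.
  - by exists (fun=> 0) => //; rewrite big1 // => j _; rewrite mul0r.
  - move=> g h [a Aa ->] [b Ab ->]; exists (fun j => a j + b j).
      by move=> j; apply: AD.
    by rewrite -big_split; apply: eq_bigr => j _; rewrite mulrDl.
  - move=> g h [a Aa ->]; exists (fun j => g * a j); first by move=> j; apply: AM.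
    by rewrite mulr_sumr; apply: eq_bigr => j _; rewrite mulrA.
have vX m : mdeg m = R -> exists i, v i = 'X_[m].
  move=> mR; have mX : (mdeg m < R.+1)%N by rewrite mR.
  by exists (enum_rank (BMultinom mX)); rewrite /v enum_rankK /= mR eqxx.
have PX g m : A g -> mdeg m = R -> P (g * 'X_[m]).
  move=> Ag /vX[i <-]; exists (fun j => if j == i then g else 0).
    by move=> j; case: ifP => // _; case: AI.
  rewrite (bigD1 i) //= eqxx big1 ?addr0 // => j /negPf ->.
  by rewrite mul0r.
have Phigh m : (R + d <= mdeg m)%N -> P 'X_[m].
  move=> Rm; pose s := (mdeg m - (R + d))%N.
  have AX : A 'X_[m].
    by apply: (full_leq AI _ AR (t := mdeg m)); [lia | rewrite dhomogX].
  apply: (@trunc_mul _ _ I P (R + s.+1) d.-1 _ PI _ AX); last first.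
    by rewrite dhomogX /= /s; apply/eqP; lia.
  move=> u g /dhomog_mf uh Ag; have [P0 PD PM] := PI.
  apply: (@mpoly_ind_supp _ _ (fun u => P (u * g))) => [||m' c /uh /= m'd].
  - by rewrite mul0r.
  - by move=> x y Px Py; rewrite mulrDl; apply: PD.
  have [m1 [m2 [d1 d2 ->]]] := mnm_split m'd.
  have -> : c *: 'X_[(m1 + m2)] * g = c%:MP * 'X_[m2] * g * 'X_[m1].
    by rewrite -mul_mpolyC mpolyXD; ring.
  by apply: PX => //; have [_ _ AM] := AI; apply: AM.
have [i0 vi0] : exists i, v i != 0.
  have [m mR] : exists m : 'X_{1..n}, mdeg m = R.
    by exists (U_(Ordinal n0) *+ R)%MM; rewrite mdegMn mdeg1 mul1n.
  have [i vi] := vX m mR; exists i; rewrite vi -msize_poly_eq0 msizeX.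
  by [].
apply: (integral_of_module AI vi0) => i.
suff : P (f * v i) by [].
rewrite /v; case: eqP => [mR|_]; last by rewrite mulr0; case: PI.
have [a Aa fa] := homogeneous_add_order IH d0 If.
have [_ PD _] := PI.
rewrite -(subrK a f) mulrDl; apply: PD; last exact: PX.
rewrite [X in X * _]mpolyE mulr_suml big_seq; apply: ideal_sum => // m /fa /= dm.
rewrite -mul_mpolyC -mulrA -mpolyXD; have [_ _ PM] := PI; apply: PM.
by apply: Phigh; rewrite mdegD mR addnC leq_add2r.
Qed.

End GeneratingDegree.

(** * Generator degrees and m-primary ideals *)

Section Generators.
Variables (k : fieldType) (n : nat).
Local Notation S := {mpoly k[n]}.
Implicit Types (I : S -> Prop).

Lemma trunc_of_gen_degrees I D f : (exists j, min_gen_degree I j) ->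
  (forall j, min_gen_degree I j -> (j <= D)%N) -> I f -> trunc_ideal I D f.
Proof.
move=> [j0 [G [g0 [Gmin Gg0 _]]]] HD.
have [Gh GI _] := Gmin; move/GI.
apply: ideal_gen_sub => [|g Gg]; first exact: is_ideal_gen.
have [j gj] := Gh g Gg; apply: ideal_genW; split; first exact/GI/ideal_genW.
by exists j => //; apply: HD; exists G, g.
Qed.

Lemma add_order_of_gen_degrees I d c f : (exists j, min_gen_degree I j) ->
    (forall j, min_gen_degree I j -> (d < j)%N -> (c <= j)%N) ->
  I f -> add_order (trunc_ideal I d) c f.
Proof.
move=> [j0 [G [g0 [Gmin Gg0 _]]]] Hc.
have [Gh GI _] := Gmin; move/GI.
have TI := trunc_is_ideal I d.
apply: ideal_gen_sub => [|g Gg]; first exact: add_order_ideal.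
have [j gj] := Gh g Gg; have [jd|dj] := leqP j d.
  exists g; last by rewrite subrr; apply: supported0.
  by apply: ideal_genW; split; [exact/GI/ideal_genW | exists j].
exists 0; first by case: TI.
rewrite subr0 => m /(dhomog_mf gj) /= mj; rewrite inE /= mj.
by apply: Hc dj; exists G, g.
Qed.

(** In no variables an m-primary ideal is zero and has no minimal generator. *)
Lemma max_gen_degree_gt0 I D : m_primary I -> max_gen_degree I D -> (0 < n)%N.
Proof.
move=> [[II I1 _] _] [[G [g [[_ GI Gmin] Gg _]]] _].
rewrite lt0n; apply/eqP => n0; apply: (Gmin _ Gg).
suff -> : g = 0 by case: (is_ideal_gen (fun h => G h /\ h <> 0 :> S)).
apply/eqP/negPn/negP => g0; apply: I1.
have Ig : I g by apply/GI/ideal_genW.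
have gE := nvar0_mpolyC_eq g n0.
move: (g@_0%MM) gE => c gE.
have c0 : c != 0 by apply: contraNneq g0 => c0; rewrite gE c0 mpolyC0.
have -> : 1 = c^-1%:MP * g by rewrite gE -mpolyCM mulVf ?mpolyC1.
by have [_ _ IM] := II; apply: IM.
Qed.

Lemma m_primary_powers I l : m_primary I -> exists N, I ('X_l ^+ N).
Proof. by move=> [_ rad]; apply/rad/ideal_genW; exists l. Qed.

End Generators.

Theorem corollary2p8 (k : fieldType) (n : nat) (I : {mpoly k[n]} -> Prop)
    (d b : nat) (b' : option nat) (e : nat -> int) (r : int) :
  [pchar k] =i pred0 ->
  homogeneous_ideal I ->
  m_primary I ->
  asymptotic_gen_degree I d ->
  (forall m : nat, (0 < m)%N ->
     regularity (ideal_pow I m) ((d * m)%N%:Z + e m)) ->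
  max_gen_degree I (d + b) ->
  next_gen_degree I d b' ->
  regularity (trunc_ideal I d) r ->
  [/\ forall m : nat, (0 < m)%N -> e m.+1 <= e m + b%:Z,
      forall m : nat, (0 < m)%N -> reg_quotient r d b' < m%:R ->
        e m.+1 <= e m
    & forall m : nat, (0 < m)%N -> (n <= m)%N -> e m.+1 <= e m].
Proof.
move=> char0 IH Ipr [Iint dmin] regI maxI nextI regJ.
have n0 := max_gen_degree_gt0 Ipr maxI.
have II : is_ideal I by case: IH.
have I1 : ~ I 1 by case: Ipr => -[].
have exg : exists j, min_gen_degree I j by exists (d + b)%N; case: maxI.
have JH := trunc_homogeneous I d.
have JI : is_ideal (trunc_ideal I d) by case: JH.
have Jpow l : exists N, trunc_ideal I d ('X_l ^+ N).
  have [N IN] := m_primary_powers l Ipr.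
  have [N' JN] := integral_power JI (Iint _ IN).
  by exists (N * N')%N; rewrite exprM.
have [tJ JtJ] := powers_full JI Jpow.
have powfull m : exists t, full (ideal_pow I m) t.
  apply: powers_full; first exact: ideal_pow_ideal.
  move=> l; have [N IN] := m_primary_powers l Ipr.
  by exists (N * m)%N; rewrite exprM; apply: ideal_powX.
(* Regularities are integers; [R] below is that of [I^m], which is positive
   because [1] is not in [I]. *)
have step m D : (0 < m)%N ->
    (forall R : nat, full (ideal_pow I m) R -> full (trunc_ideal I D) (R + D)) ->
    (d * m.+1)%N%:Z + e m.+1 <= (d * m)%N%:Z + e m + D%:Z.
  move=> m0 H; have [t It] := powfull m.
  have mI := ideal_pow_ideal I m.
  have rfull := regularity_full char0 mI It (regI _ m0) n0.
  have R0 : 0 < (d * m)%N%:Z + e m.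
    rewrite ltNge; apply/negP => /(rfull 0%N) F0; apply/I1/(ideal_pow_sub II m0).
    by apply: F0; apply: dhomog1.
  have [R RE] : exists R : nat, (d * m)%N%:Z + e m = R%:Z.
    by case: ((d * m)%N%:Z + e m) R0 => [R _|//]; exists R.
  have IR : full (ideal_pow I m) R by apply: rfull; rewrite RE.
  have [t' It'] := powfull m.+1.
  have := full_regularity char0 (ideal_pow_ideal I m.+1) (regI m.+1 isT)
    (pow_succ_full II IR (H _ IR)).
  by rewrite PoszD -RE.
have step0 m : (0 < m)%N ->
    (forall R : nat, full (ideal_pow I m) R -> full (trunc_ideal I d) (R + d)) ->
    e m.+1 <= e m.
  by move=> m0 /(step _ _ m0); rewrite mulnS PoszD; lia.
have part1 m : (0 < m)%N -> e m.+1 <= e m + b%:Z.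
  move=> m0; suff : (d * m.+1)%N%:Z + e m.+1 <= (d * m)%N%:Z + e m + (d + b)%N%:Z.
    by rewrite mulnS !PoszD; lia.
  apply: step => // R IR f fh; apply: trunc_of_gen_degrees exg _ _.
    by case: maxI.
  apply: (ideal_pow_sub II m0).
  exact: (full_leq (ideal_pow_ideal I m) (leq_addr _ _) IR fh).
split=> // m m0.
- case: b' nextI => [c [c0 _ cmin]|Id] /= rm.
    apply: step0 => // R IR.
    have [Rlt|Rge] := ltnP R ((d + c) * m).
      apply: (full_leq JI (leq_addr _ _)); apply: (pow_full_low JH _ Rlt IR) => f.
      exact: add_order_of_gen_degrees.
    apply: (regularity_full char0 JI JtJ regJ n0).
    move: rm; rewrite ltr_pdivrMr ?ltr0n ?addn_gt0 ?c0 ?orbT // -natrM.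
    by rewrite -[_%:R]mulrz_nat ltr_int; lia.
  have b0 : b = 0%N by case: maxI => /Id; lia.
  by have := part1 m m0; rewrite b0; lia.
- move=> nm; apply: step0 => // R IR.
  apply: trunc_full_of_powers => //.
  (* Now [n * d <= d * m <= R]. *)
  suff dR : (d * m <= R)%N by have := leq_mul (leqnn d) nm; lia.
  have [->|d0] := posnP d; first by rewrite mul0n.
  rewrite leqNgt; apply/negP => Rlt.
  suff /(integral_of_full IH n0 d0)/dmin : full (trunc_ideal I d.-1) R by lia.
  apply: (pow_full_low (trunc_homogeneous _ _) _ Rlt IR) => f.
  exact: homogeneous_add_order.
Qed.
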